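(* Let $\eta$ be a probability measure on $\mathbb R^d$. For $w\sim\eta$, define the random projection $$\Pi_w = I_d-\frac{w\otimes w}{|w|^2},$$ which projects any vector onto the orthogonal complement of $\operatorname{span}(w)$. Then for all $z\in\mathbb R^d$, $$\mathbb E_{w\sim\eta}|\Pi_w z|^2\ \leq\ \Bigl(1-\inf_{|\zeta|=1}\mathbb E_{w\sim\eta}\Bigl(\zeta\cdot\frac{w}{|w|}\Bigr)^2\Bigr)\,|z|^2,$$ where the infimum is over all unit vectors $\zeta\in\mathbb R^d$.
   Context: Here $|\cdot|$ is the Euclidean norm on $\mathbb R^d$, $\cdot$ the Euclidean inner product, $I_d$ the identity matrix and $w\otimes w=ww^T$. $\mathbb E_{w\sim\eta}$ denotes expectation over a random vector $w$ with law $\eta$. *)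

(* Defs.v *)
From HB Require Import structures.
From mathcomp Require Import all_boot all_order all_algebra.
From mathcomp Require Import all_classical all_reals all_analysis.
Set Implicit Arguments.
Unset Strict Implicit.
Unset Printing Implicit Defensive.
Import Order.TTheory GRing.Theory Num.Theory numFieldNormedType.Exports.
Local Open Scope classical_set_scope.
Local Open Scope ring_scope.

(* R^d with its Borel sigma-algebra: the topology of 'cV[R]_d is entrywise
   convergence, which is the Euclidean topology. *)
Definition borel_cV (R : realType) (d : nat) :=
  g_sigma_algebraType (@open 'cV[R]_d).

Definition dot (R : realType) (d : nat) (u v : 'cV[R]_d) : R :=
  \sum_(i < d) u i ord0 * v i ord0.

(* The library norm `|u| of a matrix is the sup norm. *)
Definition enorm (R : realType) (d : nat) (u : 'cV[R]_d) : R :=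
  Num.sqrt (dot u u).

(* w / |w|; as 0^-1 = 0, it is 0 when w = 0. *)
Definition normalized (R : realType) (d : nat) (w : 'cV[R]_d) : 'cV[R]_d :=
  (enorm w)^-1 *: w.

(* As 0^-1 = 0, this is the identity matrix when w = 0. *)
Definition proj_orth (R : realType) (d : nat) (w : 'cV[R]_d) : 'M[R]_d :=
  1%:M - (enorm w ^+ 2)^-1 *: (w *m w^T).

(* Main.v *)
Require Import Defs.
From HB Require Import structures.
From mathcomp Require Import all_boot all_order all_algebra.
From mathcomp Require Import all_classical all_reals all_analysis.
From mathcomp Require Import measurable_realfun ring.
Set Implicit Arguments.
Unset Strict Implicit.
Unset Printing Implicit Defensive.
Import Order.TTheory GRing.Theory Num.Theory numFieldNormedType.Exports.
Local Open Scope classical_set_scope.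
Local Open Scope ring_scope.

(** Pointwise, |Pi_w z|^2 = |z|^2 (1 - (zeta . w/|w|)^2) for the unit vector
    zeta = z/|z|; taking expectations, the term E (zeta . w/|w|)^2 is bounded
    below by its infimum over all unit vectors. *)

Lemma dotC (R : realType) (d : nat) (u v : 'cV[R]_d) : dot u v = dot v u.
Proof. by apply: eq_bigr => i _; rewrite mulrC. Qed.

Lemma dotZl (R : realType) (d : nat) (a : R) (u v : 'cV[R]_d) :
  dot (a *: u) v = a * dot u v.
Proof. by rewrite /dot mulr_sumr; apply: eq_bigr => i _; rewrite mxE mulrA. Qed.

Lemma dotZr (R : realType) (d : nat) (a : R) (u v : 'cV[R]_d) :
  dot u (a *: v) = a * dot u v.
Proof. by rewrite dotC dotZl dotC. Qed.

Lemma dotBl (R : realType) (d : nat) (u v w : 'cV[R]_d) :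
  dot (u - v) w = dot u w - dot v w.
Proof. by rewrite /dot -sumrB; apply: eq_bigr => i _; rewrite !mxE mulrBl. Qed.

Lemma dotBr (R : realType) (d : nat) (u v w : 'cV[R]_d) :
  dot u (v - w) = dot u v - dot u w.
Proof. by rewrite dotC dotBl !(dotC u). Qed.

Lemma dot_ge0 (R : realType) (d : nat) (u : 'cV[R]_d) : 0 <= dot u u.
Proof. by apply: sumr_ge0 => i _; rewrite -expr2 sqr_ge0. Qed.

Lemma enorm_sqr (R : realType) (d : nat) (u : 'cV[R]_d) :
  enorm u ^+ 2 = dot u u.
Proof. by rewrite sqr_sqrtr ?dot_ge0. Qed.

Lemma enorm_eq0 (R : realType) (d : nat) (u : 'cV[R]_d) :
  (enorm u == 0) = (u == 0).
Proof.
rewrite -sqrf_eq0 enorm_sqr; apply/eqP/eqP => [u0|->]; last first.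
  by apply: big1 => i _; rewrite mxE mul0r.
apply/matrixP => i j; rewrite (ord1 j) mxE.
(* A vanishing sum of squares has only vanishing terms. *)
have := psumr_eq0P (fun k _ => sqr_ge0 (u k ord0)) u0.
by move/(_ i isT)/eqP; rewrite sqrf_eq0 => /eqP.
Qed.

Lemma enorm_normalized (R : realType) (d : nat) (u : 'cV[R]_d) :
  u != 0 -> enorm (normalized u) = 1.
Proof.
move=> u0; rewrite /normalized {1}/enorm dotZl dotZr -enorm_sqr.
by rewrite expr2 mulKf ?enorm_eq0// mulVf ?enorm_eq0// sqrtr1.
Qed.

(** Squaring removes the square root in [normalized], leaving a rational expression in the
    coordinates, which suits both [field] and measurability. *)
Lemma dot_normalized_sqr (R : realType) (d : nat) (u w : 'cV[R]_d) :
  dot u (normalized w) ^+ 2 = dot u w ^+ 2 * (dot w w)^-1.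
Proof. by rewrite dotZr exprMn exprVn enorm_sqr mulrC. Qed.

Lemma proj_orthE (R : realType) (d : nat) (w z : 'cV[R]_d) :
  proj_orth w *m z = z - ((dot w w)^-1 * dot w z) *: w.
Proof.
rewrite /proj_orth enorm_sqr mulmxBl mul1mx -scalemxAl -mulmxA.
(* The 1 x 1 matrix [w^T *m z] acts on [w] as a scalar, namely [dot w z]. *)
rewrite [w^T *m z]mx11_scalar mul_mx_scalar scalerA.
congr (_ - (_ * _) *: _).
by rewrite mxE; apply: eq_bigr => i _; rewrite mxE.
Qed.

(** Pythagoras, by expanding the square of [z] minus its component along [w]. *)
Lemma enorm_proj_orth_sqr (R : realType) (d : nat) (w z : 'cV[R]_d) :
  enorm (proj_orth w *m z) ^+ 2 = dot z z - dot z (normalized w) ^+ 2.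
Proof.
rewrite dot_normalized_sqr enorm_sqr proj_orthE.
rewrite !(dotBl, dotBr, dotZl, dotZr) (dotC w z).
(* For [w = 0] the convention [0^-1 = 0] turns both sides into [dot z z]. *)
have [->|ww0] := eqVneq (dot w w) 0; first by rewrite invr0; ring.
by field.
Qed.

Lemma enorm_proj_orth_normalized (R : realType) (d : nat) (w z : 'cV[R]_d) :
  z != 0 -> enorm (proj_orth w *m z) ^+ 2 =
    enorm z ^+ 2 * (1 - dot (normalized z) (normalized w) ^+ 2).
Proof.
move=> z0; rewrite enorm_proj_orth_sqr dotZl exprMn mulrBr mulr1 -enorm_sqr.
by rewrite exprVn mulVKf// sqrf_eq0 enorm_eq0.
Qed.

(** Cauchy-Schwarz for free: the gap between the two sides is the squared norm of the projection of
    [u]. *)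
Lemma dot_normalized_sqr_le1 (R : realType) (d : nat) (u w : 'cV[R]_d) :
  enorm u = 1 -> dot u (normalized w) ^+ 2 <= 1.
Proof.
move=> u1; rewrite -subr_ge0 -[X in X - _](expr1n _ 2) -{1}u1 enorm_sqr.
by rewrite -enorm_proj_orth_sqr sqr_ge0.
Qed.

Lemma continuous_borel_cV_measurable (R : realType) (d : nat)
    (f : 'cV[R]_d -> R) :
  continuous f -> measurable_fun setT (f : borel_cV R d -> R).
Proof.
(* Open intervals generate the Borel sets of the line, and their preimages under [f] are open. *)
move=> /continuousP cf; apply: (measurability _ (measurable_realfun.RGenOpens.measurableE R)).
move=> _ [_ [a [b ->] <-]]; rewrite setTI; apply: sub_sigma_algebra.
exact/cf/interval_open.
Qed.

Lemma measurable_dot (R : realType) (d : nat) (disp : measure_display)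
    (T : measurableType disp) (f g : T -> 'cV[R]_d) :
  (forall i, measurable_fun setT (fun w => f w i ord0)) ->
  (forall i, measurable_fun setT (fun w => g w i ord0)) ->
  measurable_fun setT (fun w => dot (f w) (g w)).
Proof.
by move=> mf mg; apply: measurable_sum => i; exact: measurable_funM.
Qed.

Lemma measurable_dot_normalized_sqr (R : realType) (d : nat) (u : 'cV[R]_d) :
  measurable_fun setT
    (fun w : borel_cV R d => dot u (normalized (w : 'cV[R]_d)) ^+ 2).
Proof.
have mcoord (i : 'I_d) :
    measurable_fun setT (fun w : borel_cV R d => (w : 'cV[R]_d) i ord0).
  by apply: continuous_borel_cV_measurable; exact: coord_continuous.
(* The library has measurability of real powers but not of inversion. *)
under eq_fun do rewrite dot_normalized_sqr -powR_inv1 ?dot_ge0//.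
apply: measurable_funM.
  by apply: measurable_funX; apply: measurable_dot => // i; exact: measurable_cst.
apply: (measurableT_comp (measurable_powR _)); exact: measurable_dot.
Qed.

(** Bounded measurable functions are integrable for a probability measure; this licenses linearity
    of the expectation in [lemma1]. *)
Lemma Lfun_dot_normalized_sqr (R : realType) (d : nat)
    (eta : probability (borel_cV R d) R) (u : 'cV[R]_d) : enorm u = 1 ->
  (fun w : 'cV[R]_d => dot u (normalized w) ^+ 2) \in Lfun eta 1.
Proof.
move=> u1; apply/Lfun1_integrable; apply: measurable_bounded_integrable => //.
- by apply: le_lt_trans (ltry 1); apply: probability_le1; exact: measurableT.
- exact: measurable_dot_normalized_sqr.
- exists 1; split => // M M1 w _ /=.
  rewrite ger0_norm ?sqr_ge0//.
  exact: le_trans (dot_normalized_sqr_le1 _ u1) (ltW M1).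
Qed.

Theorem lemma1 (R : realType) (d : nat) (eta : probability (borel_cV R d) R)
    (z : 'cV[R]_d) :
  ('E_eta[fun w : 'cV[R]_d => (enorm (proj_orth w *m z) ^+ 2)%R] <=
   (1 - ereal_inf
          [set 'E_eta[fun w : 'cV[R]_d => (dot zeta (normalized w) ^+ 2)%R]
             | zeta in [set zeta : 'cV[R]_d | enorm zeta = 1%R]])
   * (enorm z ^+ 2)%:E)%E.
Proof.
(* The zero vector has no direction to normalize. This case includes [d = 0], where the infimum over
   the empty set is [+oo]; the product with 0 is still 0. *)
have [->|z0] := eqVneq z 0.
  have e0 : enorm (0 : 'cV[R]_d) = 0 by apply/eqP; rewrite enorm_eq0.
  under eq_fun do rewrite mulmx0 e0 expr0n.
  by rewrite e0 expr0n mule0 (expectation_cst eta 0).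
have u1 := enorm_normalized z0.
have LQ := Lfun_dot_normalized_sqr eta u1.
set Q := (fun w : 'cV[R]_d => _) in LQ.
have -> : (fun w : 'cV[R]_d => enorm (proj_orth w *m z) ^+ 2) =
    enorm z ^+ 2 \o* (cst 1 \- Q).
  by apply/funext => w; rewrite enorm_proj_orth_normalized//= mulrC.
rewrite expectationZl ?rpredB ?Lfun_cst// expectationB ?Lfun_cst//.
rewrite expectation_cst muleC lee_wpmul2r ?lee_fin ?sqr_ge0//.
(* Only the subtracted terms differ: the expectation of [Q] is the value at [normalized z] of the
   family whose infimum is taken. *)
by apply: leeB => //; apply: ereal_inf_lbound; exists (normalized z).
Qed.
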